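(* Let $\hat V_{\mathrm{mnw}}^{\pi}=n^{-1}\sum_{i=1}^n\sum_{a\in\mathcal{A}}\left(\hat g^{\pi}(p_{ia})+\pi_{ia}\hat\mu_{ia}\right)$ be the model-assisted nonparametric weighting (MNW) estimator of the target-policy value $V^{\pi}$. Here $\hat\mu_{ia}$ is an estimate of the expected reward $\mu_{ia}$, and $\hat g^{\pi}$ is the $P$-spline estimator of $g^{\pi}\in W^q$ (Sobolev space of order $q$) in the residual model $$\pi_{ia}(r_{ia}-\hat\mu_{ia})=g^{\pi}(p_{ia})+\xi_{ia}^{\pi},$$ obtained by regressing $\{\pi_{ia_i}(r_{ia_i}-\hat\mu_{ia_i})\}_{i=1}^n$ on $\{p_{ia_i}\}_{i=1}^n$. It is assumed to attain the rate $\mathbb{E}\left[(\hat g^{\pi}(p_{ia})-g^{\pi}(p_{ia}))^2\right]=O(n^{-2q/(1+2q)})$. Let $\mu_{ia}^*=\mathbb{E}(\hat\mu_{ia})$ and assume $$\mathbb{E}\left[(\hat\mu_{ia}-\mu_{ia}^* )^2\right]=O(n^{-1}).$$ Let $K=|\mathcal{A}|$. Then: (a) The bias of the MNW estimator satisfies $$\mathbb{E}(\hat V_{\mathrm{mnw}}^{\pi})-V^{\pi}=O\left(Kn^{-q/(2q+1)}\right).$$ (b) The mean squared error of the MNW estimator satisfies $$\mathbb{E}\left[(\hat V_{\mathrm{mnw}}^{\pi}-V^{\pi})^2\right]=O\left(K^2n^{-2q/(2q+1)}\right).$$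
   Context: Setting (off-policy evaluation in contextual bandits). $\mathcal{X}$ is a context space, $\mathcal{A}$ is a finite action space with $K=|\mathcal{A}|$, and $\mathcal{D}$ is a distribution over pairs $(x,r)$ with $x\in\mathcal{X}$ and $r=(r_a)_{a\in\mathcal{A}}$ a real vector of rewards for all actions. Data are generated as follows: the environment draws i.i.d. pairs $(x_i,r_i)\sim\mathcal{D}$, $i=1,\dots,n$. Given $x_i$, the behavior policy draws $a_i\in\mathcal{A}$ with probabilities $p_{ia}=\mathbb{P}(a\mid x_i)$, and only the reward $r_{ia_i}$ is revealed. Rewards satisfy $r_{ia}=\mu_{ia}+\epsilon_{ia}$ with $\mu_{ia}=\mathbb{E}[r_a\mid x_i]$ and $\epsilon_{ia}$ zero-mean with finite variance. The target policy $\pi$ chooses action $a$ at context $x_i$ with probability $\pi_{ia}=\pi(a\mid x_i)$, and its value is $V^{\pi}=\mathbb{E}_{(x,r)\sim\mathcal{D}}[r_{\pi(x)}]=\mathbb{E}\left[\sum_{a\in\mathcal{A}}\pi(a\mid x)r_a\right]$. Residual model. $\hat\mu_{ia}=\hat\mu_a(x_i)$ is an estimate of the expected reward $\mu_{ia}$ for the pair $(x_i,a)$; it may be biased, with bias described by $\mu_{ia}-\mu_{ia}^*$ where $\mu_{ia}^*=\mathbb{E}(\hat\mu_{ia})$. For each $(x_i,a)$ the model $\pi_{ia}(r_{ia}-\hat\mu_{ia})=g^{\pi}(p_{ia})+\xi_{ia}^{\pi}$ is assumed, where the $\xi_{ia}^{\pi}$ are independently distributed with mean $0$ and variance $\nu_{\pi,ia}^2$.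 Under this model $\mathbb{E}[\pi_{ia}(r_{ia}-\hat\mu_{ia})]=\pi_{ia}(\mu_{ia}-\mu_{ia}^* )=g^{\pi}(p_{ia})$. $P$-spline estimator. For a univariate regression $y_i=f(t_i)+\zeta_i$, $i=1,\dots,n$, with $t_i\in(0,1)$ and $\zeta_i$ of conditional mean zero given $t_i$, assume $f\in W^q[0,1]$, i.e. $f$ has $q-1$ absolutely continuous derivatives and $\int_0^1[f^{(q)}(t)]^2\,dt<\infty$. Let $B_1,\dots,B_{J(n)+d}$ be the $d$-th degree $B$-spline basis functions with knots $0=\kappa_0<\kappa_1<\cdots<\kappa_{J(n)}=1$, $J(n)=o(n)$. The estimator is $\hat f(t)=\sum_{k=1}^{J(n)+d}\hat\beta_kB_k(t)$, where $\hat\beta$ minimizes $$\sum_{i=1}^n\Big[y_i-\sum_{k=1}^{J(n)+d}\beta_kB_k(t_i)\Big]^2+\lambda_n\sum_{k=2}^{J(n)+d}(\beta_k-\beta_{k-1})^2.$$ Here it is applied with $y_i=\pi_{ia_i}(r_{ia_i}-\hat\mu_{ia_i})$ and $t_i=p_{ia_i}$, giving $\hat g^{\pi}$. The smoothing parameter is chosen as $\lambda_n=O(n^{-1/(1+2q)})$. Under regularity conditions the resulting optimal convergence rate is $\mathbb{E}[(\hat f(t)-f(t))^2]=O(n^{-2q/(1+2q)})$, and this rate is adopted as a standing assumption, applied at the points $p_{ia}$. The $O(\cdot)$ statements are as $n\to\infty$.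
   Formalization: The rewards are additionally assumed to have finite second moments, E[r_a^2] bounded for every action; with only finite noise variance, mean rewards of infinite variance make the mean squared error in (b) infinite. *)

(* Defs.v *)
From HB Require Import structures.
From mathcomp Require Export all_boot all_order all_algebra.
From mathcomp Require Export all_classical all_reals all_analysis.
Export Order.TTheory GRing.Theory Num.Theory.
Export numFieldNormedType.Exports.

Set Implicit Arguments.
Unset Strict Implicit.
Unset Printing Implicit Defensive.

Local Open Scope classical_set_scope.
Local Open Scope ring_scope.

Section Conditioning.
Context {R : realType} {dT : measure_display} {T : measurableType dT}.
Variable P : probability T R.

(* m is a version of E[Y | G], for a sub-sigma-algebra G of the events. *)
Definition is_cond_expectation (G : set (set T)) (Y m : T -> R) : Prop :=
  [/\ P.-integrable setT (EFin \o Y),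
      P.-integrable setT (EFin \o m),
      (forall B : set R, measurable B -> G (m @^-1` B)) &
      forall E, G E -> (\int[P]_(w in E) (m w)%:E = \int[P]_(w in E) (Y w)%:E)%E].

Definition mutually_independent (G : nat -> set (set T)) : Prop :=
  forall (s : seq nat) (E : nat -> set T), uniq s ->
    (forall i, i \in s -> G i (E i)) ->
    P (\bigcap_(i in [set` s]) E i) = (\prod_(i <- s) P (E i))%E.

(* Y_i, i : I, are independent conditionally on G:
   P(Y_i \in B_i for all i | G) = \prod_i P(Y_i \in B_i | G). *)
Definition cond_independent (I : finType) (G : set (set T)) (Y : I -> T -> R)
    : Prop :=
  forall (B : I -> set R) (h : I -> T -> R),
    (forall i, measurable (B i)) ->
    (forall i, is_cond_expectation G \1_(Y i @^-1` B i) (h i)) ->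
    is_cond_expectation G \1_(\bigcap_i (Y i @^-1` B i))
      (fun w => \prod_(i : I) h i w).

End Conditioning.

Section Sobolev.
Context {R : realType}.

Definition abs_continuous (lo hi : R) (f : R -> R) : Prop :=
  forall e : R, 0 < e -> exists2 delta : R, 0 < delta &
    forall s : seq (R * R),
      all (fun I => [&& lo <= I.1, I.1 <= I.2 & I.2 <= hi]) s ->
      pairwise (fun I J => (I.2 <= J.1) || (J.2 <= I.1)) s ->
      \sum_(I <- s) (I.2 - I.1) < delta ->
      \sum_(I <- s) `|f I.2 - f I.1| < e.

(* f \in W^q[0,1], q >= 1; F k is the k-th derivative of f.  Since F 0 need only
   agree with f on [0,1], the values of f outside [0,1] are irrelevant. *)
Definition in_sobolev (q : nat) (f : R -> R) : Prop :=
  exists F : nat -> R -> R,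
    [/\ {in `[0 : R, 1 : R], F 0%N =1 f},
        (forall k, (k < q)%N -> abs_continuous 0 1 (F k)),
        (forall k (t : R), (k.+1 < q)%N -> t \in `]0, 1[ ->
           is_derive t 1 (F k) (F k.+1 t)),
        {ae lebesgue_measure, forall t : R, t \in `]0, 1[ ->
           is_derive t 1 (F q.-1) (F q t)} &
        measurable_fun `[0 : R, 1 : R] (F q) /\
        (\int[lebesgue_measure]_(t in `[0%R : R, 1%R : R]) ((F q t) ^+ 2)%:E < +oo)%E].

End Sobolev.

Section PSpline.
Context {R : realType}.

(* Cox-de Boor recursion on a knot sequence tau; since 0^-1 = 0, terms with a
   vanishing denominator (repeated knots) are 0. *)
Fixpoint bspline (tau : nat -> R) (d k : nat) (t : R) : R :=
  if d is d'.+1 then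
    (t - tau k) / (tau (k + d)%N - tau k) * bspline tau d' k t +
    (tau (k + d).+1 - t) / (tau (k + d).+1 - tau k.+1) * bspline tau d' k.+1 t
  else ((tau k <= t) && (t < tau k.+1))%:R.

(* kappa_j is tau (d + j), 0 <= j <= J; degree d needs d further knots on either
   side of [0,1], which may be distinct or repeated boundary knots. *)
Definition is_knot_sequence (d J : nat) (tau : nat -> R) : Prop :=
  [/\ (0 < J)%N,
      tau d = 0,
      tau (d + J)%N = 1,
      (forall k, (k < J + d + d)%N -> tau k <= tau k.+1) &
      (forall j, (j < J)%N -> tau (d + j)%N < tau (d + j).+1)].

Definition spline (tau : nat -> R) (d J : nat) (b : nat -> R) (t : R) : R :=
  \sum_(k < J + d) b k * bspline tau d k t.

(* Coefficients are indexed from 0; b k is irrelevant for k >= J + d. *)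
Definition pspline_loss (tau : nat -> R) (d J : nat) (lambda : R) (n : nat)
    (y t : nat -> R) (b : nat -> R) : R :=
  \sum_(i < n) (y i - spline tau d J b (t i)) ^+ 2 +
  lambda * \sum_(1 <= k < J + d) (b k - b k.-1) ^+ 2.

End PSpline.

Section Bandit.
Context {R : realType} {dX : measure_display} {X : measurableType dX}
  {A : finType}.

(* A reward vector (r_a)_{a in A} is stored as a tuple indexed by the
   enumeration of A. *)
Definition reward (r : #|A|.-tuple R) (a : A) : R := tnth r (enum_rank a).

Definition is_policy (p : X -> A -> R) : Prop :=
  [/\ (forall a, measurable_fun setT (p^~ a)),
      (forall x a, 0 <= p x a) &
      (forall x, \sum_(a : A) p x a = 1)].

Section Population.
Variable D : probability (X * #|A|.-tuple R)%type R.

(* mu_a(x) = E[r_a | x]. *)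
Definition is_mean_reward (mu : X -> A -> R) : Prop :=
  forall a,
    is_cond_expectation D
      (g_sigma_algebra_preimage (fst : X * #|A|.-tuple R -> X))
      (fun z => reward z.2 a) (fun z => mu z.1 a).

(* V^pi = E[r_{pi(x)}]; the expectation is finite as soon as the rewards are
   integrable, so that fine is harmless. *)
Definition policy_value (target : X -> A -> R) : R :=
  fine 'E_D[fun z => \sum_(a : A) target z.1 a * reward z.2 a].

End Population.

Section Sample.
Context {dT : measure_display} {T : measurableType dT}.
Variable P : probability T R.
Variables (behav target : X -> A -> R).
Variables (ctx : nat -> T -> X) (rew : nat -> T -> #|A|.-tuple R)
  (act : nat -> T -> A).

Definition sigma_ctx_rew (i : nat) : set (set T) :=
  g_sigma_algebra_preimage (fun w => (ctx i w, rew i w)).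

Definition sigma_obs (i : nat) : set (set T) :=
  <<s sigma_ctx_rew i `|` [set [set w | act i w = a] | a in [set: A]] >>.

(* Given (x_i, r_i), the action a_i has law behav(. | x_i): the draw depends on
   the rewards only through the context. *)
Definition is_bandit_sample (D : probability (X * #|A|.-tuple R)%type R)
    : Prop :=
  [/\ (forall i, measurable_fun setT (fun w => (ctx i w, rew i w))),
      (forall i a, measurable [set w | act i w = a]),
      (forall i B, measurable B ->
         P ((fun w => (ctx i w, rew i w)) @^-1` B) = D B),
      (forall i a,
         is_cond_expectation P (sigma_ctx_rew i)
           \1_[set w | act i w = a] (fun w => behav (ctx i w) a)) &
      mutually_independent P sigma_obs].

(* muhat n is the estimated mean reward used at sample size n. *)
Variable muhat : nat -> T -> X -> A -> R.
Variable g : R -> R.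

Definition residual (n i : nat) (a : A) (w : T) : R :=
  target (ctx i w) a * (reward (rew i w) a - muhat n w (ctx i w) a)
  - g (behav (ctx i w) a).

(* mu*_{ia} = E[muhat_{ia}], the context x_i being held fixed. *)
Definition is_mean_estimate (mustar : nat -> nat -> A -> T -> R) : Prop :=
  forall n i a, (i < n)%N ->
    is_cond_expectation P (g_sigma_algebra_preimage (ctx i))
      (fun w => muhat n w (ctx i w) a) (mustar n i a).

Definition prop_obs (i : nat) (w : T) : R := behav (ctx i w) (act i w).

Definition resp_obs (n i : nat) (w : T) : R :=
  target (ctx i w) (act i w) *
  (reward (rew i w) (act i w) - muhat n w (ctx i w) (act i w)).

(* The errors of the residual model: centred with variance (nu n i a)^2 given
   x_i, and independent given x_0, ..., x_{n-1}. *)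
Definition residual_model (nu : nat -> nat -> A -> T -> R) : Prop :=
  [/\ (forall n i a, (i < n)%N ->
         is_cond_expectation P (g_sigma_algebra_preimage (ctx i))
           (residual n i a) (fun=> 0)),
      (forall n i a, (i < n)%N ->
         is_cond_expectation P (g_sigma_algebra_preimage (ctx i))
           (fun w => residual n i a w ^+ 2) (fun w => nu n i a w ^+ 2)) &
      (forall n,
         cond_independent P (g_sigma_preimage (fun i : 'I_n => ctx i))
           (fun ia : 'I_n * A => residual n ia.1 ia.2))].

(* The regression y_i = g(t_i) + zeta_i has t_i in (0,1) almost surely and
   E[zeta_i | t_i] = 0. *)
Definition regression_model : Prop :=
  (forall i, {ae P, forall w, 0 < prop_obs i w < 1}) /\
  (forall n i, (i < n)%N ->
     is_cond_expectation P (g_sigma_algebra_preimage (prop_obs i))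
       (fun w => resp_obs n i w - g (prop_obs i w)) (fun=> 0)).

Section Estimator.
Variables (d : nat) (J : nat -> nat) (tau : nat -> nat -> R) (lambda : nat -> R).
Variable betahat : nat -> T -> nat -> R.

Definition is_pspline_estimate : Prop :=
  (forall n k, measurable_fun setT (fun w => betahat n w k)) /\
  (forall n w (b : nat -> R),
     let loss := pspline_loss (tau n) d (J n) (lambda n) n
       (fun i => resp_obs n i w) (fun i => prop_obs i w) in
     loss (betahat n w) <= loss b).

Definition ghat (n : nat) (w : T) (t : R) : R :=
  spline (tau n) d (J n) (betahat n w) t.

Definition mnw (n : nat) (w : T) : R :=
  n%:R^-1 * \sum_(i < n) \sum_(a : A)
    (ghat n w (behav (ctx i w) a) +
     target (ctx i w) a * muhat n w (ctx i w) a).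

End Estimator.
End Sample.
End Bandit.

(* Main.v *)
Require Import Defs.
From mathcomp Require Import measurable_realfun finmap lra ring.

Local Open Scope classical_set_scope.
Local Open Scope ring_scope.

Set Implicit Arguments.
Unset Strict Implicit.
Unset Printing Implicit Defensive.

(* Taking expectations given x_i in the residual model shows that
   pi_ia (mu_ia - mu*_ia) = g(p_ia) almost surely.  Hence, almost surely,
     mnw - V = n^-1 sum_(i,a) [ghat(p_ia) - g(p_ia)]
             + n^-1 sum_(i,a) pi_ia (muhat_ia - mu*_ia)
             + n^-1 sum_i [sum_a pi_ia mu_ia - V].
   By Cauchy-Schwarz the first two terms have mean squares of order
   K^2 n^(-2q/(2q+1)) and K^2 n^-1.  The third is an average of n independent
   centred variables, with second moments at most K^2 sup_a E[r_a^2] by Jensen, so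
   its mean square is of order K^2 n^-1.  This gives (b), and (a) follows. *)

(** The conditional means [mustar] are given only as versions: random variables measurable for the
    sigma-algebra of [ctx i], not functions of the context. Conditioning on x_i is therefore also
    expressed through the identity map from [T] to [T] with that smaller sigma-algebra. The identity
    between g(p_ia) and pi_ia (mu_ia - mu*_ia) then holds because the difference of the two sides is
    both measurable and centred given x_i, hence null. The functions [ghat] and [muhat] may depend
    on the whole sample, so their errors at different i are dependent and no cancellation between
    them is available. This is why the first two terms go through Cauchy-Schwarz, which keeps the
    rate of a single summand and costs K^2. The terms of order n^-1 are absorbed since 2q/(2q+1) <=
    1. The bias is drawn from the mean square by a weighted AM-GM inequality instead of a square
    root. One constant, depending only on [cg], [cmu] and [cr], then serves both claims. *)

(** * Pulling a function of the conditioning variable out of an integral *)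

Section PullOut.
Import HBNNSimple.
Context {R : realType} {d d' : measure_display} {T : measurableType d}
  {X : measurableType d'}.
Variables (P : probability T R) (phi : T -> X) (Y : T -> R).
Hypothesis mphi : measurable_fun setT phi.
Hypothesis iY : P.-integrable setT (EFin \o Y).
Hypothesis Y0 : forall B, measurable B ->
  (\int[P]_(w in phi @^-1` B) (Y w)%:E = 0)%E.

Let indic_mul (B : set X) (w : T) :
  (\1_B (phi w) * Y w)%:E = ((EFin \o Y) \_ (phi @^-1` B)) w.
Proof.
rewrite patchE indicE.
have -> : (w \in phi @^-1` B) = (phi w \in B) by apply/idP/idP => /set_mem ?; exact/mem_set.
by case: ifPn => _; rewrite ?mul1r ?mul0r.
Qed.

Let mpre (B : set X) : measurable B -> measurable (phi @^-1` B).
Proof. by move=> mB; rewrite -[_ @^-1` _]setTI; exact: mphi. Qed.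

(** A simple function is a finite combination of indicators of its level sets, and [Y0] annihilates
    each of them. *)
Lemma integral_nnsfun_mul_eq0 (h : {nnsfun X >-> R}) :
  (\int[P]_w (h (phi w) * Y w)%:E = 0)%E.
Proof.
have hE w : (h (phi w) * Y w)%:E = (\sum_(y <- fset_set (range h))
    y%:E * ((EFin \o Y) \_ (phi @^-1` (h @^-1` [set y]))) w)%E.
  rewrite fimfunE fsbig_finite//= mulr_suml -sumEFin.
  by apply: eq_bigr => y _; rewrite -indic_mul -EFinM mulrA.
have mh y : measurable (h @^-1` [set y]).
  by rewrite -[X in measurable X]setTI; exact: measurable_funP.
have iYh y : P.-integrable setT ((EFin \o Y) \_ (phi @^-1` (h @^-1` [set y]))).
  apply/(integrable_mkcond _ (mpre (mh y))).
  by apply: integrableS iY => //; exact: mpre.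
under eq_integral do rewrite hE.
rewrite integral_sum//; last by move=> y; exact: integrableZl.
rewrite big1// => y _; rewrite integralZl// -integral_mkcond Y0 ?mule0//.
Qed.

(** Dominated convergence: the simple approximants stay below [k], so the integrable product itself,
    in absolute value, dominates. *)
Let ge0_pull_out (k : X -> R) : (forall x, 0 <= k x) -> measurable_fun setT k ->
  P.-integrable setT (fun w => (k (phi w) * Y w)%:E) ->
  (\int[P]_w (k (phi w) * Y w)%:E = 0)%E.
Proof.
move=> k0 mk ikY.
have mk' : measurable_fun setT (EFin \o k) by exact/measurable_EFinP.
pose h := nnsfun_approx measurableT mk'.
have mY : measurable_fun setT Y by apply/measurable_EFinP/(measurable_int P).
have hk n x : h n x <= k x.
  rewrite -lee_fin /h nnsfun_approxE.
  by rewrite (@le_approx _ _ _ setT (EFin \o k))// => y _; rewrite lee_fin.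
have [|||||_ _] := @dominated_convergence _ _ _ P setT measurableT
  (fun n w => (h n (phi w) * Y w)%:E) (fun w => (k (phi w) * Y w)%:E)
  (fun w => `|(k (phi w) * Y w)%:E|%E).
- move=> n; apply/measurable_EFinP; apply: measurable_funM => //.
  exact: measurableT_comp.
- by case/integrableP : ikY.
- apply: aeW => w _; under eq_fun do rewrite EFinM; rewrite EFinM.
  apply: cvgeZr => //; apply: cvg_nnsfun_approx => // y _.
  by rewrite lee_fin.
- exact: integrable_abse.
- apply: aeW => w n _; rewrite !abse_EFin lee_fin !normrM ler_wpM2r//.
  by rewrite !ger0_norm//.
rewrite (_ : [sequence _]_n = fun=> 0%E); last first.
  by apply/funext => n /=; exact: integral_nnsfun_mul_eq0.
by move/cvg_lim => <- //; rewrite lim_cst.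
Qed.

(** Splits [k] into positive and negative parts. Each is at most |k|, so its product with [Y]
    inherits integrability from the assumed one. *)
Lemma pull_out (k : X -> R) : measurable_fun setT k ->
  P.-integrable setT (fun w => (k (phi w) * Y w)%:E) ->
  (\int[P]_w (k (phi w) * Y w)%:E = 0)%E.
Proof.
move=> mk ikY.
have mkY : measurable_fun setT (fun w => k (phi w)) by exact: measurableT_comp.
have mY : measurable_fun setT Y by apply/measurable_EFinP/(measurable_int P).
have pm (s : R -> R) : measurable_fun setT s -> (forall x, 0 <= s x <= `|x|) ->
    P.-integrable setT (fun w => (s (k (phi w)) * Y w)%:E).
  move=> ms s0; apply: le_integrable ikY => //.
    apply/measurable_EFinP/measurable_funM => //.
    exact: measurableT_comp ms _.
  move=> w _; rewrite !abse_EFin lee_fin !normrM ler_wpM2r//.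
  by have /andP[? ?] := s0 (k (phi w)); rewrite ger0_norm.
rewrite (eq_integral (fun w => (Num.max (k (phi w)) 0 * Y w)%:E
    - (Num.max (- k (phi w)) 0 * Y w)%:E)%E); last first.
  move=> w _; rewrite -EFinB -mulrBl; congr (_ * _)%:E.
  have /orP[k0|k0] := le_total 0 (k (phi w)).
    by rewrite max_l// max_r ?subr0// oppr_le0.
  by rewrite max_r// max_l ?sub0r ?opprK// oppr_ge0.
have ip : P.-integrable setT (fun w => (Num.max (k (phi w)) 0 * Y w)%:E).
  apply: (pm (fun x => Num.max x 0)); first exact: measurable_maxr.
  by move=> x; rewrite le_max lexx orbT ge_max ler_norm normr_ge0.
have im : P.-integrable setT (fun w => (Num.max (- k (phi w)) 0 * Y w)%:E).
  apply: (pm (fun x => Num.max (- x) 0)).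
    by apply: measurable_maxr => //; exact: measurableT_comp.
  by move=> x; rewrite le_max lexx orbT ge_max -normrN ler_norm normr_ge0.
rewrite integralB//.
rewrite (ge0_pull_out (k := fun x => Num.max (k x) 0)) ?sub0e//; last 2 first.
  by move=> x; rewrite le_max lexx orbT.
  exact: measurable_maxr.
rewrite (ge0_pull_out (k := fun x => Num.max (- k x) 0)) ?oppe0//.
  by move=> x; rewrite le_max lexx orbT.
by apply: measurable_maxr => //; exact: measurableT_comp.
Qed.
End PullOut.

(** * Integrability criteria on a probability space *)

Section Integrability.
Context {R : realType} {d : measure_display} {T : measurableType d}.
Variable P : probability T R.

Lemma integrableP_measurable (f : T -> R) :
  P.-integrable setT (EFin \o f) -> measurable_fun setT f.
Proof. by move=> ?; apply/measurable_EFinP/(measurable_int P). Qed.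

Lemma sqr_integrable (f : T -> R) (c : R) : measurable_fun setT f ->
  (\int[P]_w (f w ^+ 2)%:E <= c%:E)%E ->
  P.-integrable setT (fun w => (f w ^+ 2)%:E).
Proof.
move=> mf fc; apply/integrableP; split.
  by apply/measurable_EFinP; exact: measurable_funX.
apply: le_lt_trans (ltry c); apply: le_trans fc.
by rewrite le_eqVlt; apply/orP; left; apply/eqP/eq_integral => w _;
  rewrite gee0_abs// lee_fin sqr_ge0.
Qed.

Lemma integrable_mul_sqr (f g : T -> R) :
  measurable_fun setT f -> measurable_fun setT g ->
  P.-integrable setT (fun w => (f w ^+ 2)%:E) ->
  P.-integrable setT (fun w => (g w ^+ 2)%:E) ->
  P.-integrable setT (fun w => (f w * g w)%:E).
Proof.
move=> mf mg f2 g2; apply: le_integrable (integrableD measurableT f2 g2) => //.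
  by apply/measurable_EFinP; exact: measurable_funM.
move=> w _; change (`|(f w * g w)%:E| <= `|(f w ^+ 2 + g w ^+ 2)%:E|)%E.
rewrite !abse_EFin lee_fin normrM.
rewrite (@ger0_norm _ (_ + _)) ?addr_ge0 ?sqr_ge0// -(real_normK (num_real (f w))).
rewrite -(real_normK (num_real (g w))); have := normr_ge0 (f w).
have := normr_ge0 (g w); set x := `|f w|; set y := `|g w|; nra.
Qed.

Lemma integrable_of_sqr (f : T -> R) : measurable_fun setT f ->
  P.-integrable setT (fun w => (f w ^+ 2)%:E) ->
  P.-integrable setT (EFin \o f).
Proof.
move=> mf f2; have i1 := finite_measure_integrable_cst P (1 : R).
have := @integrable_mul_sqr f (fun=> 1) mf.
rewrite (_ : (fun w => (f w * 1)%:E) = EFin \o f); last first.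
  by apply/funext => w; rewrite mulr1.
apply => //.
under eq_fun do rewrite expr1n; exact: i1.
Qed.

Lemma integrable_bounded_mul (k f : T -> R) (M : R) : measurable_fun setT k ->
  (forall w, `|k w| <= M) -> P.-integrable setT (EFin \o f) ->
  P.-integrable setT (fun w => (k w * f w)%:E).
Proof.
move=> mk kM If; have mf := integrableP_measurable If.
apply: le_integrable (integrableZl measurableT M If) => //.
  by apply/measurable_EFinP; exact: measurable_funM.
move=> w _; rewrite -EFinM !abse_EFin lee_fin !normrM ler_wpM2r//.
by rewrite (le_trans (kM w))// ler_norm.
Qed.

End Integrability.

(** * Variables with conditional mean zero *)

(** This is E[Z | phi] = 0, since the events of the sigma-algebra of [phi] are exactly the preimages
    of measurable sets. No version of a conditional expectation has to be named, which makes sums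
    and multiples easy to handle. *)
Definition cond_centred {R : realType} {d d' : measure_display}
    {T : measurableType d} {X : measurableType d'} (P : probability T R)
    (phi : T -> X) (Z : T -> R) : Prop :=
  P.-integrable setT (EFin \o Z) /\
  forall B, measurable B -> (\int[P]_(w in phi @^-1` B) (Z w)%:E = 0)%E.

Section CondCentred.
Context {R : realType} {d d' : measure_display} {T : measurableType d}
  {X : measurableType d'}.
Variables (P : probability T R) (phi : T -> X).
Hypothesis mphi : measurable_fun setT phi.

Let mpre B : measurable B -> measurable (phi @^-1` B).
Proof. by move=> mB; rewrite -[_ @^-1` _]setTI; exact: mphi. Qed.

Lemma cond_centredT Z : cond_centred P phi Z -> (\int[P]_w (Z w)%:E = 0)%E.
Proof. by case=> _ /(_ _ measurableT); rewrite preimage_setT. Qed.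

(** The indicator of a preimage under [phi] is again a function of [phi], so it merges with [k] into
    one factor to be pulled out. *)
Lemma cond_centred_mul Z (k : X -> R) : measurable_fun setT k ->
  cond_centred P phi Z -> P.-integrable setT (fun w => (k (phi w) * Z w)%:E) ->
  cond_centred P phi (fun w => k (phi w) * Z w).
Proof.
move=> mk [iZ Z0] ikZ; split=> // B mB; rewrite integral_mkcond.
have E w : (((fun w => (k (phi w) * Z w)%:E) \_ (phi @^-1` B)) w =
    (((k \* \1_B) (phi w)) * Z w)%:E)%E.
  rewrite patchE /= indicE.
  have -> : (w \in phi @^-1` B) = (phi w \in B).
    by apply/idP/idP => /set_mem ?; exact/mem_set.
  by case: ifPn => _; rewrite ?mulr1// mulr0 mul0r.
rewrite (eq_integral _ _ (fun w _ => E w)); apply: (pull_out mphi iZ Z0).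
  by apply: measurable_funM => //; exact: measurable_indic.
rewrite -(eq_fun E) -(integrable_mkcond _ (mpre mB)).
by apply: integrableS ikZ => //; exact: mpre.
Qed.

Lemma cond_centredD Z Z' : cond_centred P phi Z -> cond_centred P phi Z' ->
  cond_centred P phi (fun w => Z w + Z' w).
Proof.
move=> [iZ Z0] [iZ' Z0']; split.
  by have := integrableD measurableT iZ iZ'.
move=> B mB; under eq_integral do rewrite EFinD.
have iB (f : T -> R) : P.-integrable setT (EFin \o f) ->
    P.-integrable (phi @^-1` B) (EFin \o f).
  by apply: integrableS => //; exact: mpre.
by rewrite integralD_EFin ?Z0 ?Z0' ?adde0//; [exact: mpre|exact: iB..].
Qed.

Lemma cond_centredN Z : cond_centred P phi Z ->
  cond_centred P phi (fun w => - Z w).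
Proof.
move=> [iZ Z0]; split; first by have := integrableN iZ.
move=> B mB; under eq_integral do rewrite EFinN.
have iB : P.-integrable (phi @^-1` B) (EFin \o Z).
  by apply: integrableS iZ => //; exact: mpre.
rewrite integralN ?Z0 ?oppe0//.
exact: (integrable_add_def (mpre mB) iB).
Qed.

(** The source of almost sure identities: what is known given [phi] equals its own conditional mean.
    Nullity is recorded as a zero second moment, the form in which the mean square bounds consume
    it. *)
Lemma cond_centred_self (h : X -> R) : measurable_fun setT h ->
  cond_centred P phi (h \o phi) -> (\int[P]_w ((h (phi w)) ^+ 2)%:E = 0)%E.
Proof.
move=> mh ch; have [ih _] := ch.
have mhp : measurable_fun setT (h \o phi) by exact: measurableT_comp.
(* Pulling out the sign of [h] gives E|h| = 0. *)
pose k x : R := (0 < h x)%R%:R - (h x < 0)%R%:R.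
have kE x : k x * h x = `|h x|.
  rewrite /k; case: ltgtP => [h0|h0|<-] /=; last by rewrite mulr0 normr0.
    by rewrite subr0 mul1r gtr0_norm.
  by rewrite sub0r mulN1r ltr0_norm.
have mk : measurable_fun setT k.
  by apply: measurable_funB; apply: (measurableT_comp (f := fun b : bool => b%:R : R));
    do ?[exact: measurable_fun_ltr].
have c := cond_centred_mul mk ch; have {}c : cond_centred P phi (fun w => k (phi w) * h (phi w)).
  apply: c; apply: (@integrable_bounded_mul _ _ _ P (k \o phi) (h \o phi) 1) => //.
    exact: measurableT_comp.
  by move=> w; rewrite /k/=; case: ltgtP => _; rewrite ?subr0 ?sub0r ?normrN ?normr1 ?normr0.
have /cond_centredT := c; under eq_integral do rewrite kE -abse_EFin.
move/ae_eq_integral_abs => /(_ measurableT) H.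
have {}H := H ((measurable_EFinP _ _).2 mhp).
rewrite -(integral0 P setT).
apply: ae_eq_integral => //.
  by apply/measurable_EFinP; exact: measurable_funX.
by apply: filterS H => w /(_ I)[hw] _; rewrite hw expr0n.
Qed.

End CondCentred.

(** * Conditional Jensen inequality for squares *)

Section SecondMoments.
Context {R : realType} {d d' : measure_display} {T : measurableType d}
  {X : measurableType d'}.
Variables (P : probability T R) (phi : T -> X).
Hypothesis mphi : measurable_fun setT phi.

(* As [m] is not known to be square integrable, the bound is
   proved for the truncations [t n] of [m]. *)
Lemma cond_mean_sqr_le (Y : T -> R) (m : X -> R) (c : R) :
  measurable_fun setT Y -> measurable_fun setT m ->
  cond_centred P phi (fun w => Y w - m (phi w)) ->
  (\int[P]_w (Y w ^+ 2)%:E <= c%:E)%E ->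
  (\int[P]_w (m (phi w) ^+ 2)%:E <= c%:E)%E.
Proof.
move=> mY mm cY Yc.
pose t n x : R := m x * (`|m x| <= n%:R)%R%:R.
have mt n : measurable_fun setT (t n).
  apply: measurable_funM => //.
  apply: (measurableT_comp (f := fun b : bool => b%:R : R)) => //.
  by apply: measurable_fun_ler => //; exact: measurableT_comp.
have mtp n : measurable_fun setT (fun w => t n (phi w)) by exact: measurableT_comp.
have tn n x : `|t n x| <= n%:R.
  by rewrite /t; case: (boolP (`|m x| <= _)) => h /=; rewrite ?mulr1// mulr0 normr0.
have it2 n : P.-integrable setT (fun w => (t n (phi w) ^+ 2)%:E).
  apply: measurable_bounded_integrable => //.
  - by rewrite (le_lt_trans (probability_le1 P measurableT))// ltry.
  - exact: measurable_funX.
  exists (n%:R ^+ 2); split; first exact: num_real.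
  move=> x nx w _ /=; rewrite normrX (le_trans _ (ltW nx))//.
  by rewrite lerXn2r// nnegrE.
have itY n : P.-integrable setT (fun w => (t n (phi w) * (Y w - m (phi w)))%:E).
  apply: (integrable_bounded_mul (k := fun w => t n (phi w)) (M := n%:R)) => //.
  by case: cY.
have i2Y n : P.-integrable setT
    (fun w => (2 * (t n (phi w) * (Y w - m (phi w))))%:E).
  by under eq_fun do rewrite EFinM; exact: integrableZl.
have t_le n : (\int[P]_w (t n (phi w) ^+ 2)%:E <= c%:E)%E.
  have /(cond_centredT) E := cond_centred_mul mphi (mt n) cY (itY n).
  (* The added term has mean zero by [E]. With it the integrand lies below [Y ^+ 2]: the gap is the
     square of Y - m where the truncation is inactive, and Y^2 where it cuts [m] to 0. *)
  have -> : (\int[P]_w (t n (phi w) ^+ 2)%:E =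
      \int[P]_w (t n (phi w) ^+ 2 + 2 * (t n (phi w) * (Y w - m (phi w))))%:E)%E.
    under [RHS]eq_integral do rewrite EFinD.
    rewrite integralD//.
    under [X in (_ + X)%E]eq_integral do rewrite EFinM.
    by rewrite integralZl// E mule0 adde0.
  apply: (le_trans _ Yc); apply: le_integral => //.
  - under eq_fun do rewrite EFinD; exact: integrableD.
  - exact: sqr_integrable Yc.
  move=> w _; rewrite lee_fin /t.
  case: (`|_| <= _) => /=; last first.
    by rewrite !(mulr0, mul0r, expr0n, addr0) sqr_ge0.
  rewrite mulr1 -subr_ge0 (_ : _ - _ = (Y w - m (phi w)) ^+ 2) ?sqr_ge0//.
  by ring.
have lim_t w : limn (fun n => (t n (phi w) ^+ 2)%:E) = (m (phi w) ^+ 2)%:E.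
  apply/cvg_lim => //; apply: cvg_near_cst; near=> n.
  rewrite /t (_ : _ <= _) ?mulr1//.
  by near: n; exact: nbhs_infty_ger.
have t_nd w i j : (i <= j)%N -> t i (phi w) ^+ 2 <= t j (phi w) ^+ 2.
  move=> ij; rewrite /t; case: (boolP (`|m _| <= i%:R)) => h /=; last first.
    by rewrite mulr0 expr0n sqr_ge0.
  by rewrite (le_trans h) ?ler_nat.
under eq_integral do rewrite -lim_t.
rewrite monotone_convergence//.
- apply: lime_le; last by apply: nearW => n; exact: t_le.
  apply: ereal_nondecreasing_is_cvgn => i j ij; apply: ge0_le_integral => //.
  + by move=> w _; rewrite lee_fin sqr_ge0.
  + by apply/measurable_EFinP; exact: measurable_funX.
  + by apply/measurable_EFinP; exact: measurable_funX.
  + by move=> w _; rewrite lee_fin t_nd.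
- by move=> n; apply/measurable_EFinP; exact: measurable_funX.
- by move=> n w _; rewrite lee_fin sqr_ge0.
- by move=> w _ i j ij; rewrite lee_fin t_nd.
Unshelve. all: by end_near. Qed.

End SecondMoments.

(** * From independence to conditional centring *)

Section Independence.
Context {R : realType} {d d1 d2 : measure_display} {T : measurableType d}
  {X1 : measurableType d1} {X2 : measurableType d2}.
Variables (P : probability T R) (phi : T -> X1) (psi : T -> X2).
Hypotheses (mphi : measurable_fun setT phi) (mpsi : measurable_fun setT psi).
Hypothesis ind : forall B C, measurable B -> measurable C ->
  (P (phi @^-1` B `&` psi @^-1` C) = P (phi @^-1` B) * P (psi @^-1` C))%E.

Let mpre1 B : measurable B -> measurable (phi @^-1` B).
Proof. by move=> mB; rewrite -[_ @^-1` _]setTI; exact: mphi. Qed.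

Let mpre2 B : measurable B -> measurable (psi @^-1` B).
Proof. by move=> mB; rewrite -[_ @^-1` _]setTI; exact: mpsi. Qed.

(** Over a preimage of [B] the integral is the joint probability minus the product of the two
    probabilities, which [ind] equates. *)
Lemma indep_indic_centred C : measurable C ->
  cond_centred P phi (fun w => \1_(psi @^-1` C) w - fine (P (psi @^-1` C))).
Proof.
move=> mC; have mC' := mpre2 mC.
have i1 : P.-integrable setT (EFin \o \1_(psi @^-1` C)) by exact: integrable_indic.
have i2 : P.-integrable setT (EFin \o (fun=> fine (P (psi @^-1` C)))).
  exact: finite_measure_integrable_cst.
split; first by have := integrableB measurableT i1 i2.
move=> B mB; have mB' := mpre1 mB.
have iB (f : T -> R) : P.-integrable setT (EFin \o f) ->
    P.-integrable (phi @^-1` B) (EFin \o f).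
  by apply: integrableS.
under eq_integral do rewrite EFinB.
rewrite integralB_EFin//; [|exact: iB..].
rewrite integral_indic// integral_cst// fineK ?fin_num_measure//.
have E := ind mB mC; rewrite setIC muleC in E.
apply: (eq_trans (congr1 (fun x => x - _)%E E)).
by rewrite subee// fin_numM// fin_num_measure.
Qed.

(** Roles are exchanged: instead of conditioning on [psi], the function f(phi) is pulled out of
    1_C(psi) - P(C), which is centred given [phi]. The integral of f(phi) over the event is thus
    P(C) times its mean, that is, 0. *)
Lemma indep_centred (f : X1 -> R) : measurable_fun setT f ->
  P.-integrable setT (EFin \o (f \o phi)) -> (\int[P]_w (f (phi w))%:E = 0)%E ->
  cond_centred P psi (f \o phi).
Proof.
move=> mf If f0; split=> // C mC; have mC' := mpre2 mC.
have mfp : measurable_fun setT (f \o phi) by exact: measurableT_comp.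
pose p := fine (P (psi @^-1` C)).
have Ib : P.-integrable setT
    (fun w => (f (phi w) * (\1_(psi @^-1` C) w - p))%:E).
  under eq_fun do rewrite mulrC.
  apply: (integrable_bounded_mul (k := fun w => \1_(psi @^-1` C) w - p)
    (f := f \o phi) (M := 1 + `|p|)) => //.
    by apply: measurable_funB => //; exact: measurable_indic.
  move=> w; rewrite (le_trans (ler_normB _ _))// lerD2r indicE.
  by case: (_ \in _); rewrite ?normr1 ?normr0.
have := cond_centredT (cond_centred_mul mphi mf (indep_indic_centred mC) Ib).
have Ip : P.-integrable setT (fun w => (p * f (phi w))%:E).
  by under eq_fun do rewrite EFinM; exact: integrableZl.
have IC : P.-integrable setT (fun w => ((f \o phi) w * \1_(psi @^-1` C) w)%:E).
  under eq_fun do rewrite mulrC.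
  apply: (integrable_bounded_mul (k := \1_(psi @^-1` C))
    (f := f \o phi) (M := 1)) => //.
  by move=> w; rewrite indicE; case: (_ \in _); rewrite ?normr1 ?normr0.
rewrite (eq_integral (fun w => ((f \o phi) w * \1_(psi @^-1` C) w)%:E -
  (p * f (phi w))%:E)%E); last by move=> w _; rewrite -EFinB mulrBr (mulrC p).
rewrite integralB_EFin//.
under [X in (_ - X)%E = _ -> _]eq_integral do rewrite EFinM.
rewrite integralZl// f0 mule0 sube0 => E.
rewrite integral_mkcond -[RHS]E; apply: eq_integral => w _.
rewrite patchE indicE; case: (_ \in _) => /=; first by rewrite mulr1.
by rewrite mulr0.
Qed.

End Independence.

(** * Mean squares and means of averages *)

(** Sum 2 x_i x_j <= x_i^2 + x_j^2 over all pairs (i, j). *)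
Lemma sqr_sum_le {R : realFieldType} (I : finType) (x : I -> R) :
  (\sum_i x i) ^+ 2 <= #|I|%:R * \sum_i x i ^+ 2.
Proof.
rewrite -(ler_pM2l (x := 2)) ?ltr0n//.
have -> : 2 * (#|I|%:R * \sum_i x i ^+ 2) =
    \sum_i \sum_j (x i ^+ 2 + x j ^+ 2).
  under [RHS]eq_bigr do rewrite big_split /= sumr_const.
  by rewrite big_split /= sumr_const sumrMnl -mulr_natl; ring.
rewrite expr2 mulr_suml mulr_sumr ler_sum// => i _.
rewrite !mulr_sumr ler_sum// => j _.
by rewrite -subr_ge0 (_ : _ - _ = (x i - x j) ^+ 2) ?sqr_ge0//; ring.
Qed.

Section Averages.
Context {R : realType} {d : measure_display} {T : measurableType d}.
Variable P : probability T R.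

(** Nothing is assumed on the joint behaviour of the summands. Cauchy-Schwarz over n |A| terms,
    divided by n^2, leaves the factor [k]; the n |A| second moments then cancel n and bring the
    second |A|. *)
Lemma mean_sqr_double_average (n : nat) (A : finType) (x : 'I_n -> A -> T -> R)
    (c : R) : (0 < n)%N ->
  (forall i a, measurable_fun setT (x i a)) ->
  (forall i a, (\int[P]_w (x i a w ^+ 2)%:E <= c%:E)%E) ->
  (\int[P]_w ((n%:R^-1 * \sum_i \sum_a x i a w) ^+ 2)%:E
    <= (#|A|%:R ^+ 2 * c)%:E)%E.
Proof.
move=> n0 mx xc.
have n0' : (0 : R) < n%:R by rewrite ltr0n.
pose k : R := #|A|%:R / n%:R.
have ix i a : P.-integrable setT (fun w => (x i a w ^+ 2)%:E).
  exact: sqr_integrable (xc i a).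
have mS : measurable_fun setT (fun w => \sum_i \sum_a x i a w).
  by apply: measurable_sum => i; exact: measurable_sum.
apply: (@le_trans _ _ (\int[P]_w (k%:E * \sum_i \sum_a (x i a w ^+ 2)%:E))%E).
  apply: ge0_le_integral => //.
  - by move=> w _; rewrite lee_fin sqr_ge0.
  - apply/measurable_EFinP/measurable_funX/measurable_funM => //.
  - apply: emeasurable_funM => //.
    apply: emeasurable_sum => i; apply: emeasurable_sum => a.
    by apply/measurable_EFinP; exact: measurable_funX.
  move=> w _; under [X in (_ <= _ * X)%E]eq_bigr do rewrite sumEFin; rewrite sumEFin -EFinM lee_fin.
  rewrite !pair_bigA /= exprMn /k.
  have := sqr_sum_le (fun p : 'I_n * A => x p.1 p.2 w).
  rewrite card_prod card_ord natrM => h.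
  rewrite exprVn ler_pdivrMl ?exprn_gt0// (le_trans h)// le_eqVlt; apply/orP; left.
  by apply/eqP; field; rewrite gt_eqF.
rewrite integralZl//; last first.
  by apply: integrable_sum => // i _; exact: integrable_sum.
rewrite integral_sum//; last by move=> i; exact: integrable_sum.
under eq_bigr do rewrite integral_sum//.
apply: (@le_trans _ _ (k%:E * \sum_(i < n) \sum_(a : A) c%:E)%E).
  rewrite lee_wpmul2l ?lee_fin ?divr_ge0//.
  by apply: lee_sum => i _; apply: lee_sum => a _.
under eq_bigr do rewrite sumEFin; rewrite sumEFin -EFinM lee_fin.
rewrite !sumr_const card_ord /k -(mulr_natl c) -(mulr_natl (_ * c)) le_eqVlt; apply/orP; left.
by apply/eqP; field; rewrite gt_eqF.
Qed.

(** Orthogonality leaves only the n diagonal terms of the expanded square, against the factor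
    n^-2. *)
Lemma mean_sqr_average (n : nat) (Z : 'I_n -> T -> R) (c : R) : (0 < n)%N ->
  (forall i, measurable_fun setT (Z i)) ->
  (forall i, (\int[P]_w (Z i w ^+ 2)%:E <= c%:E)%E) ->
  (forall i j, i != j -> (\int[P]_w (Z i w * Z j w)%:E = 0)%E) ->
  (\int[P]_w ((n%:R^-1 * \sum_i Z i w) ^+ 2)%:E <= (c / n%:R)%:E)%E.
Proof.
move=> n0 mZ Zc Z0.
have n0' : (0 : R) < n%:R by rewrite ltr0n.
have iZ i : P.-integrable setT (fun w => (Z i w ^+ 2)%:E).
  exact: sqr_integrable (Zc i).
have iZZ i j : P.-integrable setT (fun w => (Z i w * Z j w)%:E).
  exact: integrable_mul_sqr.
have E w : ((n%:R^-1 * \sum_i Z i w) ^+ 2)%:E =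
    ((n%:R ^- 2)%:E * \sum_i \sum_j (Z i w * Z j w)%:E)%E.
  under [X in _ = (_ * X)%E]eq_bigr do rewrite sumEFin; rewrite sumEFin -EFinM exprMn exprVn.
  congr (_ * _)%:E; rewrite expr2 mulr_suml; apply: eq_bigr => i _.
  by rewrite mulr_sumr.
under eq_integral do rewrite E.
rewrite integralZl//; last first.
  by apply: integrable_sum => // i _; exact: integrable_sum.
rewrite integral_sum//; last by move=> i; exact: integrable_sum.
under eq_bigr do rewrite integral_sum//.
apply: (@le_trans _ _ ((n%:R ^- 2)%:E * \sum_(i < n) c%:E)%E).
  rewrite lee_wpmul2l ?lee_fin ?invr_ge0 ?exprn_ge0//.
  apply: lee_sum => i _; rewrite (bigD1 i)//= big1 ?adde0; first exact: Zc.
  by move=> j ij; apply: Z0; rewrite eq_sym.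
rewrite sumEFin -EFinM lee_fin sumr_const card_ord -mulr_natl le_eqVlt.
by apply/orP; left; apply/eqP; field; rewrite gt_eqF.
Qed.

(** Here [t] stands for the scale of the root mean square. Weighting by [t] balances both halves of
    AM-GM, so (1 + c) / 2 replaces the square root of c. *)
Lemma mean_of_mean_sqr (Q : T -> R) (c t : R) : 0 < t -> measurable_fun setT Q ->
  (\int[P]_w (Q w ^+ 2)%:E <= (c * t ^+ 2)%:E)%E ->
  (`| \int[P]_w (Q w)%:E | <= ((1 + c) / 2 * t)%:E)%E.
Proof.
move=> t0 mQ Qc; have iQ2 := sqr_integrable mQ Qc.
apply: (le_trans (le_abse_integral _ _ _)) => //; first exact/measurable_EFinP.
have i1 := finite_measure_integrable_cst P (t / 2) measurableT.
have i2 : P.-integrable setT (fun w => ((t^-1 / 2)%:E * (Q w ^+ 2)%:E)%E).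
  exact: integrableZl.
(* AM-GM: |Q| <= (t + Q^2 / t) / 2 *)
apply: (@le_trans _ _
    (\int[P]_w ((t / 2)%R%:E + (t^-1 / 2)%:E * (Q w ^+ 2)%:E))%E).
  apply: ge0_le_integral => //.
  - by apply/measurable_EFinP; exact: measurableT_comp.
  - by have /integrableP[] := integrableD measurableT i1 i2.
  move=> w _; rewrite /= -EFinM -EFinD lee_fin -(ler_pM2l t0).
  rewrite (_ : t * (_ + _) = (t ^+ 2 + Q w ^+ 2) / 2); last by field; rewrite gt_eqF.
  rewrite -(real_normK (num_real (Q w))); have := sqr_ge0 (t - `|Q w|); nra.
rewrite integralD// integral_cst//= probability_setT mule1 integralZl//.
have : ((t^-1 / 2)%:E * \int[P]_w (Q w ^+ 2)%:E <= (t^-1 / 2)%:E * (c * t ^+ 2)%:E)%E.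
  by rewrite lee_wpmul2l// lee_fin divr_ge0// invr_ge0 ltW.
move/(leeD2l (t / 2)%:E) => /le_trans; apply.
rewrite -EFinM -EFinD lee_fin le_eqVlt; apply/orP; left.
by apply/eqP; field; rewrite gt_eqF.
Qed.

End Averages.

(** * Measurability of splines and of Sobolev functions *)

Section Measurability.
Context {R : realType}.

Lemma measurable_bspline (tau : nat -> R) d k :
  measurable_fun setT (bspline tau d k).
Proof.
elim: d k => [|d IH] k /=.
  apply: (measurableT_comp (f := fun b : bool => b%:R : R)) => //.
  by apply: measurable_and; [exact: measurable_fun_ler|exact: measurable_fun_ltr].
by apply: measurable_funD; apply: measurable_funM => //; apply: measurable_funM => //;
  exact: measurable_funB.
Qed.

(** Families made of a single interval already give continuity on [0,1]; the two cases put the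
    endpoints in order. *)
Lemma abs_continuous_measurable (f : R -> R) : abs_continuous 0 1 f ->
  measurable_fun `[0 : R, 1 : R] f.
Proof.
move=> fac; apply: subspace_continuous_measurable_fun => //.
apply/subspace_continuousP => x x01; apply/cvgrPdist_lt => e e0.
have [delta delta0 fd] := fac e e0.
have xd : \forall y \near x, `|x - y| < delta by exact: nbhsx_ballx.
rewrite near_withinE; near=> y => y01.
have xyd : `|x - y| < delta by near: y.
move: x01 y01; rewrite /= !in_itv /= => /andP[x0 x1] /andP[y0 y1].
have [xy|/ltW yx] := leP x y.
  have := fd [:: (x, y)]; rewrite /= !big_seq1 /= x0 xy y1 distrC => -> //.
  by rewrite (le_lt_trans (ler_norm _))// distrC.
have := fd [:: (y, x)]; rewrite /= !big_seq1 /= y0 yx x1 => -> //.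
by rewrite (le_lt_trans (ler_norm _)).
Unshelve. all: by end_near. Qed.

(** Outside [0,1] the function [g] is arbitrary, so measurability is available only after
    composition with a map into [0,1], here a probability. Positivity of [q] makes [F 0] absolutely
    continuous. *)
Lemma in_sobolev_measurable_comp (q : nat) (g : R -> R) (d : measure_display)
    (T : measurableType d) (p : T -> R) : (0 < q)%N -> in_sobolev q g ->
  measurable_fun setT p -> (forall w, 0 <= p w <= 1) ->
  measurable_fun setT (g \o p).
Proof.
move=> q0 [F [Fg Fac _ _ _]] mp p01.
have mg : measurable_fun `[0 : R, 1 : R] g.
  apply: eq_measurable_fun (abs_continuous_measurable (Fac _ q0)) => x.
  by move=> /set_mem; exact: Fg.
apply: (measurable_comp (F := `[0 : R, 1 : R])) mg mp => //.
by move=> _ [w _ <-]; rewrite /= in_itv /=.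
Qed.

End Measurability.

(** * Change of variables along a random element of law [D] *)

Section Transfer.
Context {R : realType} {d d' : measure_display} {T : measurableType d}
  {Y : measurableType d'}.
Variables (P : probability T R) (D : probability Y R) (Phi : T -> Y).
Hypothesis mPhi : measurable_fun setT Phi.
Hypothesis lawPhi : forall B, measurable B -> P (Phi @^-1` B) = D B.

Lemma ge0_integral_law (f : Y -> \bar R) : measurable_fun setT f ->
  (forall y, 0 <= f y)%E -> (\int[P]_w f (Phi w) = \int[D]_y f y)%E.
Proof.
move=> mf f0; have := ge0_integral_pushforward mPhi P measurableT mf.
rewrite preimage_setT => <-; last by move=> y _; exact: f0.
by apply: eq_measure_integral => B mB _; exact: lawPhi.
Qed.

Lemma integrable_law (f : Y -> R) : D.-integrable setT (EFin \o f) ->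
  P.-integrable setT (EFin \o (f \o Phi)).
Proof.
move=> If; have mf := integrableP_measurable If.
apply/integrableP; split.
  by apply/measurable_EFinP; exact: measurableT_comp.
rewrite (ge0_integral_law (f := fun y => `|(f y)%:E|%E))//.
  by case/integrableP: If.
by apply/measurable_EFinP; exact: measurableT_comp.
Qed.

Lemma integral_law (f : Y -> R) (B : set Y) : measurable B ->
  D.-integrable setT (EFin \o f) ->
  (\int[P]_(w in Phi @^-1` B) (f (Phi w))%:E = \int[D]_(y in B) (f y)%:E)%E.
Proof.
move=> mB If.
have mf : measurable_fun setT (EFin \o f).
  by apply/measurable_EFinP; exact: integrableP_measurable If.
have Ip : P.-integrable (Phi @^-1` B) ((EFin \o f) \o Phi).
  apply: integrableS (integrable_law If) => //.
  by rewrite -[_ @^-1` _]setTI; exact: mPhi.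
rewrite -(integral_pushforward mPhi mf Ip mB).
by apply: eq_measure_integral => C mC _; exact: lawPhi.
Qed.

End Transfer.

(** * Conditional expectations as centring over a sub-sigma-algebra *)

Section ConditionalExpectation.
Context {R : realType} {d d' : measure_display} {T : measurableType d}
  {X : measurableType d'}.
Variables (P : probability T R) (phi : T -> X).
Hypothesis mphi : measurable_fun setT phi.

(** Centring given [phi] amounts to centring given the identity into [T']. The latter also accepts
    factors and versions that are [T']-measurable without being written as functions of [phi]. *)
Local Notation T' := (g_sigma_algebra_preimageType phi).
Local Notation to_sub := (id : T -> T').

Lemma measurable_to_sub : measurable_fun setT to_sub.
Proof.
move=> _ B [C mC <-]; rewrite setTI preimage_setI preimage_setT.
by rewrite setTI; rewrite -[X in measurable X]setTI; exact: mphi.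
Qed.

Lemma measurable_sub_phi : measurable_fun setT (phi : T' -> X).
Proof. by move=> _ C mC; exists C. Qed.

Lemma cond_centred_sub Z : cond_centred P phi Z -> cond_centred P to_sub Z.
Proof.
move=> [iZ Z0]; split=> // B [C mC <-].
by rewrite setTI; exact: Z0.
Qed.

Lemma is_cond_expectation_measurable Y m :
  is_cond_expectation P (g_sigma_algebra_preimage phi) Y m ->
  measurable_fun setT (m : T' -> R).
Proof. by case=> _ _ mm _ _ B mB; rewrite setTI; exact: mm. Qed.

Lemma is_cond_expectation_centred Y m :
  is_cond_expectation P (g_sigma_algebra_preimage phi) Y m ->
  cond_centred P to_sub (fun w => Y w - m w).
Proof.
move=> [iY im _ E]; split; first by have := integrableB measurableT iY im.
move=> B mB; under eq_integral do rewrite EFinB.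
have mB' : measurable (to_sub @^-1` B).
  by rewrite -[X in measurable X]setTI; exact: measurable_to_sub.
have iB (f : T -> R) : P.-integrable setT (EFin \o f) ->
    P.-integrable (to_sub @^-1` B) (EFin \o f).
  by apply: integrableS.
rewrite integralB_EFin//; [|exact: iB..].
rewrite (E _ mB) subee//.
by apply: (@integrable_fin_num _ _ _ P _ _ (EFin \o Y)) => //; exact: iB.
Qed.

End ConditionalExpectation.

(** * Consequences of the sampling scheme *)

Section BanditModel.
Context {R : realType} {dX dT : measure_display} {X : measurableType dX}
  {A : finType} {T : measurableType dT}.
Variables (D : probability (X * #|A|.-tuple R)%type R) (P : probability T R).
Variables (behav target mu : X -> A -> R).
Variables (ctx : nat -> T -> X) (rew : nat -> T -> #|A|.-tuple R)
  (act : nat -> T -> A).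

Lemma policy_in01 (p : X -> A -> R) x a : is_policy p -> 0 <= p x a <= 1.
Proof.
move=> [_ p0 p1]; rewrite p0 /= -(p1 x) (bigD1 a)//= lerDl.
by apply: sumr_ge0 => b _; exact: p0.
Qed.

Lemma measurable_reward a :
  measurable_fun setT (fun r : #|A|.-tuple R => reward r a).
Proof. exact: measurable_tnth. Qed.

Hypothesis mean_mu : is_mean_reward D mu.

(** The hypothesis concerns [mu] only as a function on pairs, with preimages that are cylinders over
    measurable sets of contexts. Pairing each context with the zero reward vector recovers the base
    of the cylinder. *)
Lemma measurable_mean_reward a : measurable_fun setT (mu^~ a).
Proof.
move=> _ B mB; rewrite setTI.
have [_ _ /(_ B mB)[C mC CE] _] := mean_mu a.
rewrite (_ : _ @^-1` B = C)//; apply/seteqP; split=> x xP.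
  have : (setT `&` fst @^-1` C) (x, [tuple of nseq #|A| (0 : R)]) by rewrite CE.
  by case.
have : (setT `&` fst @^-1` C) (x, [tuple of nseq #|A| (0 : R)]) by split.
by rewrite CE.
Qed.

Hypothesis sample : is_bandit_sample P behav ctx rew act D.

Lemma measurable_ctx_rew i : measurable_fun setT (fun w => (ctx i w, rew i w)).
Proof. by case: sample. Qed.

Lemma measurable_ctx i : measurable_fun setT (ctx i).
Proof. exact: (measurableT_comp measurable_fst (measurable_ctx_rew i)). Qed.

Lemma measurable_rew i a : measurable_fun setT (fun w => reward (rew i w) a).
Proof.
have := measurableT_comp measurable_snd (measurable_ctx_rew i).
exact: measurableT_comp (measurable_reward a).
Qed.

Lemma law_ctx_rew i B : measurable B ->
  P ((fun w => (ctx i w, rew i w)) @^-1` B) = D B.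
Proof. by case: sample => _ _ + _ _; exact. Qed.

(** Transports the defining property of [mu] from [D] to the sample: an event about [ctx i] is a
    cylinder event about the pair (x_i, r_i), which has law [D]. *)
Lemma reward_mean_centred i a : cond_centred P (ctx i)
  (fun w => reward (rew i w) a - mu (ctx i w) a).
Proof.
pose f (z : X * #|A|.-tuple R) := reward z.2 a - mu z.1 a.
have [If f0] := is_cond_expectation_centred measurable_fst (mean_mu a).
split; first exact: (integrable_law (measurable_ctx_rew i) (@law_ctx_rew i) If).
move=> B mB.
have mB' : measurable ((fst : X * #|A|.-tuple R -> X) @^-1` B).
  by rewrite -[X in measurable X]setTI; exact: measurable_fst.
rewrite (integral_law (f := f) (measurable_ctx_rew i) (@law_ctx_rew i) mB' If).
by apply: (f0 (fst @^-1` B)); exists B => //; rewrite setTI.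
Qed.

Lemma contexts_indep i j B C : i != j -> measurable B -> measurable C ->
  (P (ctx i @^-1` B `&` ctx j @^-1` C) =
   P (ctx i @^-1` B) * P (ctx j @^-1` C))%E.
Proof.
move=> ij mB mC; case: sample => _ _ _ _.
have obs k E : measurable E -> sigma_obs ctx rew act k (ctx k @^-1` E).
  move=> mE; apply: sub_sigma_algebra; left; exists (E `*` setT).
    exact: measurableX.
  by rewrite setTI; apply/seteqP; split=> [w []|w].
pose E k := if k == i then ctx i @^-1` B else ctx j @^-1` C.
move=> /(_ [:: i; j] E); rewrite !big_cons big_nil mule1 /E eqxx.
rewrite eq_sym (negbTE ij) => <-.
- congr (P _); apply/seteqP; split=> [w [wi wj] k /=|w /= wE].
    by rewrite !inE => /orP[|] /eqP ->; rewrite ?eqxx// eq_sym (negbTE ij).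
  split; first by have := wE i; rewrite eqxx; apply; rewrite /= !inE eqxx.
  by have := wE j; rewrite eq_sym (negbTE ij); apply; rewrite /= !inE eqxx orbT.
- by rewrite /= inE ij.
- move=> k; rewrite !inE => /orP[|] /eqP ->; rewrite ?eqxx; first exact: obs.
  by rewrite eq_sym (negbTE ij); exact: obs.
Qed.

End BanditModel.

(** * The residual model and the fitting errors *)

Section Model.
Context {R : realType} {dX dT : measure_display} {X : measurableType dX}
  {A : finType} {T : measurableType dT}.
Variables (D : probability (X * #|A|.-tuple R)%type R) (P : probability T R).
Variables (behav target mu : X -> A -> R).
Variables (ctx : nat -> T -> X) (rew : nat -> T -> #|A|.-tuple R)
  (act : nat -> T -> A) (muhat : nat -> T -> X -> A -> R)
  (mustar : nat -> nat -> A -> T -> R) (g : R -> R) (q n : nat).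
Hypotheses (q0 : (0 < q)%N) (pol_behav : is_policy behav)
  (pol_target : is_policy target) (mean_mu : is_mean_reward D mu)
  (sample : is_bandit_sample P behav ctx rew act D)
  (muhatE : is_mean_estimate P ctx muhat mustar) (gq : in_sobolev q g)
  (residual0 : forall i a, (i < n)%N ->
     is_cond_expectation P (g_sigma_algebra_preimage (ctx i))
       (residual behav target ctx rew muhat g n i a) (fun=> 0)).

Let mctx i : measurable_fun setT (ctx i).
Proof. exact: measurable_ctx sample i. Qed.

Lemma target_norm_le1 x a : `|target x a| <= 1.
Proof. by have /andP[? ?] := policy_in01 x a pol_target; rewrite ger0_norm. Qed.

(* Vanishes where pi_ia (mu_ia - mu*_ia) = g(p_ia). *)
Definition model_defect (i : nat) (a : A) (w : T) : R :=
  target (ctx i w) a * (mu (ctx i w) a - mustar n i a w)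
  - g (behav (ctx i w) a).

(** Measurability for the sigma-algebra of [ctx i], rather than that of [T], is what lets
    [cond_centred_self] apply to the defect. *)
Lemma measurable_model_defect i a : (i < n)%N ->
  measurable_fun setT
    (model_defect i a : g_sigma_algebra_preimageType (ctx i) -> R).
Proof.
move=> ltin; have mx := @measurable_sub_phi _ _ T X (ctx i).
have [mtarget _ _] := pol_target; have [mbehav _ _] := pol_behav.
apply: measurable_funB.
  apply: measurable_funM.
    exact: (measurableT_comp (mtarget a) mx).
  apply: measurable_funB.
    exact: (measurableT_comp (measurable_mean_reward mean_mu a) mx).
  exact: is_cond_expectation_measurable (muhatE a ltin).
apply: (in_sobolev_measurable_comp q0 gq).
  exact: (measurableT_comp (mbehav a) mx).
by move=> w; exact: policy_in01.
Qed.

(** The defect equals residual - pi (r - mu) + pi (muhat - mustar). The three terms are centred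
    given x_i, by [c1], [c2] and [c3], where the bounded factor pi is a function of x_i. *)
Lemma model_defect_null i a : (i < n)%N ->
  (\int[P]_w (model_defect i a w ^+ 2)%:E = 0)%E.
Proof.
move=> ltin.
pose T' := g_sigma_algebra_preimageType (ctx i).
pose to_sub := id : T -> T'.
have mid : measurable_fun setT to_sub := measurable_to_sub (mctx i).
have [mtarget _ _] := pol_target.
have mt : measurable_fun setT (fun w : T' => target (ctx i w) a).
  exact: (measurableT_comp (mtarget a) (@measurable_sub_phi _ _ T X (ctx i))).
have tmul Z : cond_centred P to_sub Z ->
    cond_centred P to_sub (fun w => target (ctx i w) a * Z w).
  move=> cZ; apply: (cond_centred_mul mid mt cZ).
  apply: (integrable_bounded_mul (k := fun w : T => target (ctx i w) a) (M := 1)).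
  - exact: (measurableT_comp (mtarget a) (mctx i)).
  - by move=> w; exact: target_norm_le1.
  - by case: cZ.
have c1 := is_cond_expectation_centred (mctx i) (residual0 a ltin).
have c2 := tmul _ (cond_centred_sub (reward_mean_centred mean_mu sample i a)).
have c3 := tmul _ (is_cond_expectation_centred (mctx i) (muhatE a ltin)).
apply: (cond_centred_self mid (measurable_model_defect a ltin)).
have := cond_centredD mid (cond_centredD mid c1 (cond_centredN mid c2)) c3.
congr (cond_centred P to_sub _); apply/funext => w.
by rewrite /model_defect /residual /to_sub /=; ring.
Qed.


(* Subtracting [model_defect], which is 0 almost surely, makes [fitting_errorE]
   hold everywhere. *)
Definition fitting_error (gh : T -> R -> R) (i : nat) (a : A) (w : T) : R :=
  gh w (behav (ctx i w) a) - g (behav (ctx i w) a)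
  + target (ctx i w) a * (muhat n w (ctx i w) a - mustar n i a w)
  - model_defect i a w.

Lemma fitting_errorE gh i a w :
  gh w (behav (ctx i w) a) + target (ctx i w) a * muhat n w (ctx i w) a =
  fitting_error gh i a w + target (ctx i w) a * mu (ctx i w) a.
Proof. by rewrite /fitting_error /model_defect; ring. Qed.

Section FittingError.
Variables (gh : T -> R -> R) (i : nat) (a : A) (cu cs : R).
Hypotheses (ltin : (i < n)%N)
  (mgh : measurable_fun setT (fun w => gh w (behav (ctx i w) a)))
  (gh_le : (\int[P]_w ((gh w (behav (ctx i w) a) - g (behav (ctx i w) a)) ^+ 2)%:E
    <= cu%:E)%E)
  (muhat_le : (\int[P]_w ((muhat n w (ctx i w) a - mustar n i a w) ^+ 2)%:E
    <= cs%:E)%E).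

Let mdefect : measurable_fun setT (model_defect i a).
Proof.
exact: (measurableT_comp (measurable_model_defect a ltin)
  (measurable_to_sub (mctx i))).
Qed.

Let mg : measurable_fun setT (fun w => g (behav (ctx i w) a)).
Proof.
have [mbehav _ _] := pol_behav; apply: (in_sobolev_measurable_comp q0 gq).
  exact: (measurableT_comp (mbehav a) (mctx i)).
by move=> w; exact: policy_in01.
Qed.

Let mtarget_ctx : measurable_fun setT (fun w => target (ctx i w) a).
Proof.
by have [mtarget _ _] := pol_target; exact: (measurableT_comp (mtarget a) (mctx i)).
Qed.

Let mmuhat : measurable_fun setT (fun w => muhat n w (ctx i w) a - mustar n i a w).
Proof.
have [i1 i2 _ _] := muhatE a ltin.
by apply: measurable_funB; exact: (@integrableP_measurable _ _ _ P).
Qed.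

Lemma measurable_fitting_error : measurable_fun setT (fitting_error gh i a).
Proof.
apply: measurable_funB => //; apply: measurable_funD; first exact: measurable_funB.
exact: measurable_funM.
Qed.

(** The 3 comes from squaring a sum of three terms. The weight [target] is at most 1 in absolute
    value, and the defect contributes nothing. *)
Lemma fitting_error_sqr_le :
  (\int[P]_w (fitting_error gh i a w ^+ 2)%:E <= (3 * (cu + cs))%:E)%E.
Proof.
pose u w := gh w (behav (ctx i w) a) - g (behav (ctx i w) a).
pose s w := muhat n w (ctx i w) a - mustar n i a w.
have mU : measurable_fun setT u by exact: measurable_funB.
have msq (f : T -> R) : measurable_fun setT f ->
    measurable_fun setT (fun w => (f w ^+ 2)%:E).
  by move=> mf; apply/measurable_EFinP; exact: measurable_funX.
have ge0 (f : T -> R) w : (0 <= (f w ^+ 2)%:E)%E by rewrite lee_fin sqr_ge0.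
have E : (\int[P]_w (3%:E * ((u w ^+ 2)%:E + (s w ^+ 2)%:E +
    (model_defect i a w ^+ 2)%:E)) <= (3 * (cu + cs))%:E)%E.
  rewrite ge0_integralZl//; last 2 first.
  - apply: emeasurable_funD; last exact: msq.
    by apply: emeasurable_funD; exact: msq.
  - by move=> w _; rewrite !adde_ge0.
  rewrite ge0_integralD//; last 3 first.
  - by move=> w _; rewrite adde_ge0.
  - by apply: emeasurable_funD; exact: msq.
  - exact: msq.
  rewrite ge0_integralD//; [|exact: msq..].
  by rewrite model_defect_null// adde0 EFinM lee_wpmul2l// EFinD leeD.
apply: le_trans E; apply: ge0_le_integral => //.
- exact: msq measurable_fitting_error.
- apply: measurable_funeM; apply: emeasurable_funD; last exact: msq.
  by apply: emeasurable_funD; exact: msq.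
move=> w _; rewrite -!EFinD -EFinM lee_fin /fitting_error -/(u w) -/(s w).
have := target_norm_le1 (ctx i w) a.
move: (u w) (s w) (model_defect i a w) (target (ctx i w) a) => x y z t t1.
have ty : (t * y) ^+ 2 <= y ^+ 2.
  rewrite exprMn ler_piMl ?sqr_ge0// -(real_normK (num_real t)).
  by rewrite exprn_ile1.
(* With v = t y, these three squares add up exactly to 3 (x^2 + v^2 + z^2) - (x + v - z)^2. *)
have := sqr_ge0 (x - t * y); have := sqr_ge0 (x + z); have := sqr_ge0 (t * y + z).
move: ty; set v := t * y; nra.
Qed.

End FittingError.

(** * Fluctuation of the target value over the sampled contexts *)

Definition context_value (x : X) : R := \sum_(a : A) target x a * mu x a.

Lemma measurable_context_value : measurable_fun setT context_value.
Proof.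
apply: measurable_sum => a; have [mtarget _ _] := pol_target.
by apply: measurable_funM => //; exact: measurable_mean_reward mean_mu a.
Qed.

Lemma reward_integrable i a :
  P.-integrable setT (EFin \o (fun w => reward (rew i w) a)).
Proof.
have [Ir _ _ _] := mean_mu a.
exact: (integrable_law (measurable_ctx_rew sample i) (law_ctx_rew sample i) Ir).
Qed.

Section ContextValue.
Variables (cr : R).
Hypothesis reward_le : forall a,
  (\int[D]_z (reward z.2 a ^+ 2)%:E <= cr%:E)%E.

Lemma mean_reward_sqr_le i a : (\int[P]_w (mu (ctx i w) a ^+ 2)%:E <= cr%:E)%E.
Proof.
have c := reward_mean_centred mean_mu sample i a.
apply: (cond_mean_sqr_le (mctx i) _ (measurable_mean_reward mean_mu a) c).
  exact: measurable_rew sample i a.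
pose f (z : X * #|A|.-tuple R) := (reward z.2 a ^+ 2)%:E.
rewrite (ge0_integral_law (f := f) (measurable_ctx_rew sample i)
  (law_ctx_rew sample i)).
- exact: reward_le.
- apply/measurable_EFinP/measurable_funX.
  exact: (measurableT_comp (measurable_reward a) measurable_snd).
- by move=> z; rewrite lee_fin sqr_ge0.
Qed.

(** One factor |A| is due to Cauchy-Schwarz over the actions, the other to adding the |A| Jensen
    bounds. *)
Lemma context_value_sqr_le i :
  (\int[P]_w (context_value (ctx i w) ^+ 2)%:E <= (#|A|%:R ^+ 2 * cr)%:E)%E.
Proof.
have mm a : measurable_fun setT (fun w => (mu (ctx i w) a ^+ 2)%:E).
  apply/measurable_EFinP/measurable_funX.
  exact: (measurableT_comp (measurable_mean_reward mean_mu a) (mctx i)).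
have ge0 a w : (0 <= (mu (ctx i w) a ^+ 2)%:E)%E by rewrite lee_fin sqr_ge0.
apply: (@le_trans _ _
  (\int[P]_w (#|A|%:R%:E * \sum_(a : A) (mu (ctx i w) a ^+ 2)%:E))%E).
  apply: ge0_le_integral => //.
  - by move=> w _; rewrite lee_fin sqr_ge0.
  - apply/measurable_EFinP/measurable_funX.
    exact: (measurableT_comp measurable_context_value (mctx i)).
  - by apply: measurable_funeM; exact: emeasurable_sum.
  move=> w _; rewrite sumEFin -EFinM lee_fin (le_trans (sqr_sum_le _))//.
  rewrite ler_wpM2l// ler_sum// => a _; rewrite exprMn ler_piMl ?sqr_ge0//.
  by rewrite -(real_normK (num_real _)) exprn_ile1// target_norm_le1.
rewrite ge0_integralZl//; last 2 first.
- exact: emeasurable_sum.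
- by move=> w _; exact: sume_ge0.
rewrite ge0_integral_sum//.
apply: (@le_trans _ _ (#|A|%:R%:E * \sum_(a : A) cr%:E)%E).
  by rewrite lee_wpmul2l// lee_sum// => a _; exact: mean_reward_sqr_le.
by rewrite sumEFin -EFinM sumr_const -(mulr_natl cr) mulrA expr2.
Qed.

Lemma context_value_integrable i :
  P.-integrable setT (EFin \o (context_value \o ctx i)).
Proof.
have m : measurable_fun setT (context_value \o ctx i).
  exact: (measurableT_comp measurable_context_value (mctx i)).
exact: (integrable_of_sqr m (sqr_integrable m (context_value_sqr_le i))).
Qed.

(** Tower property: after transport to the i-th draw, each [target] times (reward - mu) has mean
    zero because [target] depends on the context only. *)
Lemma policy_valueE i :
  ((policy_value D target)%:E = \int[P]_w (context_value (ctx i w))%:E)%E.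
Proof.
have [mtarget _ _] := pol_target.
have Ir a : D.-integrable setT
    (fun z : X * #|A|.-tuple R => (target z.1 a * reward z.2 a)%:E).
  have [Ir _ _ _] := mean_mu a.
  apply: (integrable_bounded_mul (M := 1) (k := fun z => target z.1 a)
    (f := fun z => reward z.2 a)) => //.
    exact: (measurableT_comp (mtarget a) measurable_fst).
  by move=> z; exact: target_norm_le1.
pose f (z : X * #|A|.-tuple R) := \sum_a target z.1 a * reward z.2 a.
have If : D.-integrable setT (EFin \o f).
  have -> : EFin \o f = (fun z => \sum_a (target z.1 a * reward z.2 a)%:E)%E.
    by apply/funext => z; rewrite /= sumEFin.
  exact: integrable_sum.
rewrite /policy_value unlock fineK; last exact: (integrable_fin_num _ If).
have := integral_law (measurable_ctx_rew sample i)
  (law_ctx_rew sample i) measurableT If.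
rewrite preimage_setT => <-; rewrite /f /context_value /=.
under eq_integral do rewrite -sumEFin.
under [RHS]eq_integral do rewrite -sumEFin.
have mt a : measurable_fun setT (fun w => target (ctx i w) a).
  exact: (measurableT_comp (mtarget a) (mctx i)).
have Imul a (Z : T -> R) : P.-integrable setT (EFin \o Z) ->
    P.-integrable setT (fun w => (target (ctx i w) a * Z w)%:E).
  apply: (integrable_bounded_mul (M := 1) (k := fun w => target (ctx i w) a)) => //.
  by move=> w; exact: target_norm_le1.
have Imu a : P.-integrable setT (EFin \o (fun w => mu (ctx i w) a)).
  have m := measurableT_comp (measurable_mean_reward mean_mu a) (mctx i).
  exact: (integrable_of_sqr m (sqr_integrable m (mean_reward_sqr_le i a))).
rewrite !integral_sum//; last 2 first.
- by move=> a; apply: Imul; exact: Imu.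
- by move=> a; apply: Imul; exact: reward_integrable.
apply: eq_bigr => a _.
have c := reward_mean_centred mean_mu sample i a; have [Ic _] := c.
have := cond_centredT (cond_centred_mul (mctx i) (mtarget a) c (Imul a _ Ic)).
under [X in X = _ -> _]eq_integral do rewrite mulrBr EFinB.
rewrite integralB_EFin//; last 2 first.
- exact: Imul (reward_integrable i a).
- exact: Imul (Imu a).
move=> /eqP; rewrite sube_eq ?add0e; first by move/eqP.
- exact: (integrable_fin_num measurableT (Imul a _ (reward_integrable i a))).
by rewrite fin_num_adde_defr.
Qed.


Definition value_deviation (x : X) : R := context_value x - policy_value D target.

Lemma measurable_value_deviation : measurable_fun setT value_deviation.
Proof. by apply: measurable_funB => //; exact: measurable_context_value. Qed.

Let mdev i : measurable_fun setT (value_deviation \o ctx i).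
Proof. exact: (measurableT_comp measurable_value_deviation (mctx i)). Qed.

Lemma value_deviation_integrable i :
  P.-integrable setT (EFin \o (value_deviation \o ctx i)).
Proof.
have i1 := finite_measure_integrable_cst P (policy_value D target) measurableT.
by have := integrableB measurableT (context_value_integrable i) i1.
Qed.

Lemma value_deviation_mean i :
  (\int[P]_w (value_deviation (ctx i w))%:E = 0)%E.
Proof.
have i1 := finite_measure_integrable_cst P (policy_value D target) measurableT.
under eq_integral do rewrite EFinB.
rewrite integralB_EFin//; last exact: context_value_integrable.
rewrite integral_cst//= probability_setT mule1 -(policy_valueE i) subee//.
Qed.

(** Variance is at most second moment: W^2 - 2 V (W - V) exceeds (W - V)^2 by V^2, and W - V has
    mean zero. *)
Lemma value_deviation_sqr_le i :
  (\int[P]_w (value_deviation (ctx i w) ^+ 2)%:E <= (#|A|%:R ^+ 2 * cr)%:E)%E.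
Proof.
have mW := measurableT_comp measurable_context_value (mctx i).
have iW2 := sqr_integrable mW (context_value_sqr_le i).
pose V := policy_value D target.
have iV : P.-integrable setT (fun w => (2 * V * value_deviation (ctx i w))%:E).
  by under eq_fun do rewrite EFinM; apply: integrableZl => //;
    exact: value_deviation_integrable.
apply: (@le_trans _ _ (\int[P]_w ((context_value (ctx i w) ^+ 2)%:E -
    (2 * V * value_deviation (ctx i w))%:E))%E).
  apply: ge0_le_integral => //.
  - by move=> w _; rewrite lee_fin sqr_ge0.
  - by apply/measurable_EFinP/measurable_funX; exact: mdev.
  - by have /integrableP[] := integrableB measurableT iW2 iV.
  move=> w _; rewrite -EFinB lee_fin /value_deviation -/V -subr_ge0.
  by rewrite (_ : _ - _ = V ^+ 2) ?sqr_ge0//; ring.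
rewrite integralB_EFin//.
under [X in (_ - X <= _)%E]eq_integral do rewrite EFinM.
rewrite integralZl//; last exact: value_deviation_integrable.
by rewrite value_deviation_mean mule0 sube0 context_value_sqr_le.
Qed.

(** By independence the deviation at x_j is centred given x_i, and the deviation at x_i can be
    pulled out. *)
Lemma value_deviation_uncorrelated i j : i != j ->
  (\int[P]_w (value_deviation (ctx i w) * value_deviation (ctx j w))%:E = 0)%E.
Proof.
rewrite eq_sym => ji.
have c := indep_centred (mctx j) (mctx i) (fun B C => contexts_indep sample ji (B := B) (C := C))
  measurable_value_deviation (value_deviation_integrable j) (value_deviation_mean j).
have sqr_int k := sqr_integrable (mdev k) (value_deviation_sqr_le k).
apply: (cond_centredT (cond_centred_mul (mctx i) measurable_value_deviation c _)).
exact: integrable_mul_sqr (mdev i) (mdev j) (sqr_int i) (sqr_int j).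
Qed.

Lemma sample_value_sqr_le (m : nat) : (0 < m)%N ->
  (\int[P]_w ((m%:R^-1 * \sum_(i < m) value_deviation (ctx i w)) ^+ 2)%:E
   <= (#|A|%:R ^+ 2 * cr / m%:R)%:E)%E.
Proof.
move=> m0; apply: (mean_sqr_average (Z := fun i w => value_deviation (ctx i w))) => //.
- by move=> i; exact: mdev.
- by move=> i; exact: value_deviation_sqr_le.
- by move=> i j ij; exact: value_deviation_uncorrelated.
Qed.

End ContextValue.

End Model.

(** * Combination of the bounds *)

Theorem proposition4p1 (R : realType) (q : nat) (cg cmu cr : R) (hq : (0 < q)%N) :
  exists C : R,
  forall (dX : measure_display) (X : measurableType dX) (A : finType)
    (D : probability (X * #|A|.-tuple R)%type R)
    (behav target mu : X -> A -> R)
    (dT : measure_display) (T : measurableType dT) (P : probability T R)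
    (ctx : nat -> T -> X) (rew : nat -> T -> #|A|.-tuple R) (act : nat -> T -> A)
    (muhat : nat -> T -> X -> A -> R) (mustar nu : nat -> nat -> A -> T -> R)
    (g : R -> R)
    (d : nat) (J : nat -> nat) (tau : nat -> nat -> R) (lambda : nat -> R)
    (betahat : nat -> T -> nat -> R) (N : nat),
  is_policy behav ->
  is_policy target ->
  is_mean_reward D mu ->
  (forall a : A, 'E_D[fun z => (reward z.2 a ^+ 2)%R] <= cr%:E)%E ->
  is_bandit_sample P behav ctx rew act D ->
  is_mean_estimate P ctx muhat mustar ->
  in_sobolev q g ->
  residual_model P behav target ctx rew muhat g nu ->
  regression_model P behav target ctx rew act muhat g ->
  (forall n, is_knot_sequence d (J n) (tau n)) ->
  (fun n => (J n)%:R : R) =o_\oo (fun n => n%:R : R) ->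
  (forall n, 0 <= lambda n) ->
  lambda =O_\oo (fun n => n%:R `^ (- (1 / (1 + 2 * q%:R))) : R) ->
  is_pspline_estimate behav target ctx rew act muhat d J tau lambda betahat ->
  (0 < N)%N ->
  (forall (n i : nat) (a : A), (N <= n)%N -> (i < n)%N ->
     'E_P[fun w => ((ghat d J tau betahat n w (behav (ctx i w) a)
                     - g (behav (ctx i w) a)) ^+ 2)%R]
     <= (cg * n%:R `^ (- (2 * q%:R / (1 + 2 * q%:R))))%:E)%E ->
  (forall (n i : nat) (a : A), (N <= n)%N -> (i < n)%N ->
     'E_P[fun w => ((muhat n w (ctx i w) a - mustar n i a w) ^+ 2)%R]
     <= (cmu * n%:R^-1)%:E)%E ->
  forall n, (N <= n)%N ->
    (`| 'E_P[mnw behav target ctx muhat d J tau betahat n]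
        - (policy_value D target)%:E |
     <= (C * #|A|%:R * n%:R `^ (- (q%:R / (2 * q%:R + 1))))%:E)%E
    /\
    ('E_P[fun w => ((mnw behav target ctx muhat d J tau betahat n w
                     - policy_value D target) ^+ 2)%R]
     <= (C * #|A|%:R ^+ 2 * n%:R `^ (- (2 * q%:R / (2 * q%:R + 1))))%:E)%E.
Proof.
(* From Q^2 <= 2 (U^2 + Z^2): 6 is 2 times the 3 of [fitting_error_sqr_le], and 2 |cr| comes from
   [Z]. Absolute values keep [c0] nonnegative for any given constants. The witness c0 + 1 dominates
   both c0, for the mean squared error, and (1 + c0) / 2, for the bias. *)
pose c0 := 6 * (`|cg| + `|cmu|) + 2 * `|cr|.
have c0_ge0 : 0 <= c0 by rewrite addr_ge0// mulr_ge0// addr_ge0.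
exists (c0 + 1).
move=> dX X A D behav target mu dT T P ctx rew act muhat mustar nu g d J tau lambda
  betahat N pol_behav pol_target mean_mu reward_le sample muhatE gq resid _ _ _ _ _
  [mbeta _] N0 gh_le muhat_le n Nn.
have n0 : (0 < n)%N := leq_trans N0 Nn.
have n0' : (0 : R) < n%:R by rewrite ltr0n.
(* With no actions the target probabilities would sum to 0 instead of 1. Positivity is needed for
   the scale |A| rho in [mean_of_mean_sqr]. *)
have K0 : (0 : R) < #|A|%:R.
  rewrite ltr0n lt0n; apply/negP => /eqP A0.
  have [_ _ /(_ (ctx 0%N point))] := pol_target.
  by rewrite big_pred0 => [/eqP|a]; [rewrite eq_sym oner_eq0|
    have := fintype0 a A0].
pose rho : R := n%:R `^ (- (q%:R / (2 * q%:R + 1))).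
have rho0 : 0 < rho by rewrite powR_gt0.
have rho2 : n%:R `^ (- (2 * q%:R / (2 * q%:R + 1))) = rho ^+ 2 :> R.
  by rewrite /rho -powR_mulrn ?powR_ge0// -powRrM; congr (_ `^ _); field; rewrite gt_eqF.
(* As n >= 1 and 2q/(2q+1) <= 1, the errors of order n^-1, from [muhat] and from the sampled
   contexts, fit under the spline rate. *)
have ninv : n%:R^-1 <= rho ^+ 2 :> R.
  rewrite -rho2 -powR_inv1 ?ler0n//; apply: ler_powR; first by rewrite ler1n.
  by rewrite lerN2 ler_pdivrMr ?mul1r ?lerDl// ltr_wpDl// mulr_ge0.
have [resid0 _ _] := resid.
have {}resid0 i a (ltin : (i < n)%N) := resid0 n i a ltin.
rewrite rho2.
have mgh i a : measurable_fun setT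
    (fun w => ghat d J tau betahat n w (behav (ctx i w) a)).
  have [mbehav _ _] := pol_behav.
  apply: measurable_sum => k; apply: measurable_funM; first exact: mbeta.
  have mc := measurable_ctx sample i.
  exact: (measurableT_comp (measurable_bspline _ _ _)
    (measurableT_comp (mbehav a) mc)).
pose gh := ghat d J tau betahat n.
pose F i a := fitting_error behav target mu ctx muhat mustar g n gh i a.
have F_le (i : 'I_n) a : (\int[P]_w (F i a w ^+ 2)%:E
    <= (3 * (`|cg| + `|cmu|) * rho ^+ 2)%:E)%E.
  rewrite -mulrA (mulrDl `|cg|).
  apply: (fitting_error_sqr_le hq pol_behav pol_target mean_mu sample muhatE gq
    resid0 (ltn_ord i) (mgh i a)).
  - have := gh_le n i a Nn (ltn_ord i); rewrite unlock => /le_trans; apply.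
    by rewrite lee_fin (addrC 1) rho2 ler_wpM2r ?sqr_ge0// ler_norm.
  have := muhat_le n i a Nn (ltn_ord i); rewrite unlock => /le_trans; apply.
  rewrite lee_fin; apply: (@le_trans _ _ (`|cmu| * n%:R^-1)).
    by rewrite ler_wpM2r ?invr_ge0 ?ler0n// ler_norm.
  by rewrite ler_wpM2l.
have mF (i : 'I_n) a : measurable_fun setT (F i a).
  exact: (measurable_fitting_error hq pol_behav pol_target mean_mu sample muhatE gq
    (ltn_ord i) (mgh i a)).
have {}reward_le a : (\int[D]_z (reward z.2 a ^+ 2)%:E <= `|cr|%:E)%E.
  have := reward_le a; rewrite unlock => /le_trans; apply.
  by rewrite lee_fin ler_norm.
pose V := policy_value D target.
pose U w := n%:R^-1 * \sum_(i < n) \sum_a F i a w.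
pose Z w := n%:R^-1 * \sum_(i < n) value_deviation D target mu (ctx i w).
pose Q w := mnw behav target ctx muhat d J tau betahat n w - V.
have QE w : Q w = U w + Z w.
  rewrite /Q /mnw /U /Z -mulrDr -big_split /=.
  have -> : V = n%:R^-1 * \sum_(i < n) V.
    by rewrite sumr_const card_ord -(mulr_natl V) mulKf// gt_eqF.
  rewrite -mulrBr -sumrB; congr (_ * _); apply: eq_bigr => i _.
  rewrite /value_deviation addrA -big_split /=; congr (_ - _).
  by apply: eq_bigr => a _; exact: fitting_errorE.
have mU : measurable_fun setT U.
  apply: measurable_funM => //; apply: measurable_sum => i.
  by apply: measurable_sum => a; exact: mF.
have mZ : measurable_fun setT Z.
  apply: measurable_funM => //; apply: measurable_sum => i.
  exact: (measurableT_comp (measurable_value_deviation pol_target mean_mu)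
    (measurable_ctx sample i)).
have mQ : measurable_fun setT Q.
  rewrite (_ : Q = U \+ Z); first exact: measurable_funD.
  by apply/funext => w; rewrite QE.
have U_le := mean_sqr_double_average n0 (fun i a => mF i a) (fun i a => F_le i a).
have Z_le := sample_value_sqr_le pol_target mean_mu sample reward_le n0.
have msq (f : T -> R) : measurable_fun setT f ->
    measurable_fun setT (fun w => (f w ^+ 2)%:E).
  by move=> mf; apply/measurable_EFinP; exact: measurable_funX.
have ge0 (f : T -> R) w : (0 <= (f w ^+ 2)%:E)%E by rewrite lee_fin sqr_ge0.
have Q_le : (\int[P]_w (Q w ^+ 2)%:E <= (c0 * (#|A|%:R * rho) ^+ 2)%:E)%E.
  apply: (@le_trans _ _
      (\int[P]_w (2%:E * ((U w ^+ 2)%:E + (Z w ^+ 2)%:E)))%E).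
    apply: ge0_le_integral => //; first exact: msq.
      by apply: measurable_funeM; apply: emeasurable_funD; exact: msq.
    move=> w _; rewrite -EFinD -EFinM lee_fin QE -subr_ge0.
    by rewrite (_ : _ - _ = (U w - Z w) ^+ 2) ?sqr_ge0//; ring.
  rewrite ge0_integralZl//; last 2 first.
  - by apply: emeasurable_funD; exact: msq.
  - by move=> w _; rewrite adde_ge0.
  rewrite ge0_integralD//; [|exact: msq..].
  apply: (@le_trans _ _ (2%:E * ((#|A|%:R ^+ 2 * (3 * (`|cg| + `|cmu|) * rho ^+ 2))%:E
      + (#|A|%:R ^+ 2 * `|cr| / n%:R)%:E))%E).
    by rewrite lee_wpmul2l// leeD.
  rewrite -EFinD -EFinM lee_fin.
  apply: (@le_trans _ _ (2 * (#|A|%:R ^+ 2 * (3 * (`|cg| + `|cmu|) * rho ^+ 2) +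
      #|A|%:R ^+ 2 * `|cr| * rho ^+ 2))).
    by rewrite ler_pM2l// lerD2l ler_wpM2l// mulr_ge0// sqr_ge0.
  by rewrite le_eqVlt; apply/orP; left; apply/eqP; rewrite /c0; ring.
have t0 : 0 < #|A|%:R * rho by rewrite mulr_gt0.
have iQ := integrable_of_sqr mQ (sqr_integrable mQ Q_le).
split; rewrite unlock; last first.
  apply: (le_trans Q_le); rewrite lee_fin exprMn mulrA ler_wpM2r ?sqr_ge0//.
  by rewrite ler_wpM2r ?sqr_ge0// lerDl.
have -> : (\int[P]_w (mnw behav target ctx muhat d J tau betahat n w)%:E - V%:E =
    \int[P]_w (Q w)%:E)%E.
  have iV := finite_measure_integrable_cst P V measurableT.
  have -> : (\int[P]_w (mnw behav target ctx muhat d J tau betahat n w)%:E =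
      \int[P]_w ((Q w)%:E + V%:E))%E.
    by apply: eq_integral => w _; rewrite -EFinD /Q subrK.
  by rewrite integralD_EFin// integral_cst//= probability_setT mule1 addeK.
(* The bias is the mean of [Q], and its scale is t = |A| rho, whose square is the scale in
   [Q_le]. *)
apply: (le_trans (mean_of_mean_sqr t0 mQ Q_le)).
by rewrite -/rho lee_fin -(mulrA (c0 + 1)) ler_wpM2r ?(ltW t0)//; lra.
Qed.
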